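(* Let $\mathsf V=(\mathsf V,\otimes,\mathsf k)$ be a completely distributive quantale. Then the assignment $$A_\varepsilon:(\beta,\mathsf V)\text{-}\mathbf{Alg}\to \mathsf V\text{-}\mathbf{Cls},\qquad (X,\ell)\mapsto (X,c_\ell),\qquad (c_\ell A)(x)=\bigvee_{\mathfrak x\in \mathsf UX,\ A\in\mathfrak x}(\ell\mathfrak x)(x)\quad(A\subseteq X,\ x\in X),$$ (identical on underlying maps) is a functor which embeds $(\beta,\mathsf V)\text{-}\mathbf{Alg}$ into $\mathsf V\text{-}\mathbf{Cls}$ as a full coreflective subcategory, and this subcategory is precisely the category $\mathsf V\text{-}\mathbf{App}$ of $\mathsf V$-approach spaces.
   Context: A quantale $\mathsf V=(\mathsf V,\otimes,\mathsf k)$ is a complete lattice with a (not necessarily commutative) monoid structure whose operation $\otimes$ preserves arbitrary suprema in each variable; no relation between $\mathsf k$ and $\bot,\top$ is assumed. It is completely distributive if its underlying complete lattice is. $\mathsf PX$ is the power set of $X$. A $\mathsf V$-closure space $(X,c)$ is a set $X$ with a map $c:\mathsf PX\to\mathsf V^X$ such that (R') $\mathsf k\le c(\{x\})(x)$ for all $x\in X$; (T') $\big(\bigwedge_{y\in B}\bigvee_{A\in\mathcal A}(cA)(y)\big)\otimes (cB)(z)\le c(\bigcup\mathcal A)(z)$ for all $\mathcal A\subseteq\mathsf PX$, $B\subseteq X$, $z\in X$. A morphism (contractive map) $f:(X,c)\to(Y,d)$ is a map with $(cA)(x)\le (d f(A))(f(x))$ for all $A\subseteq X$, $x\in X$. This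 gives the category $\mathsf V\text{-}\mathbf{Cls}$. Its full subcategory $\mathsf V\text{-}\mathbf{App}$ consists of the $\mathsf V$-approach spaces, i.e. those $(X,c)$ with $(c\emptyset)(x)=\bot$ and $c(A\cup B)(x)=(cA)(x)\vee(cB)(x)$ for all $x\in X$, $A,B\subseteq X$. $\mathsf UX$ is the set of ultrafilters on $X$; $\dot x$ is the principal ultrafilter at $x$; for $f:X\to Y$, $f[\mathfrak x]=\{B\subseteq Y: f^{-1}B\in\mathfrak x\}$; for $\mathfrak X\in\mathsf U\mathsf UX$, $\Sigma_X\mathfrak X\in\mathsf UX$ is given by $A\in\Sigma_X\mathfrak X\iff\{\mathfrak x\in\mathsf UX: A\in\mathfrak x\}\in\mathfrak X$. An object of $(\beta,\mathsf V)\text{-}\mathbf{Alg}$ is a set $X$ with a map $\ell:\mathsf UX\to\mathsf V^X$ such that (R'') $\mathsf k\le\ell(\dot x)(x)$ for all $x\in X$; (T'') $\big(\bigwedge_{\mathcal A\in\mathfrak X,\,B\in\mathfrak y}\bigvee_{\mathfrak x\in\mathcal A,\,y\in B}(\ell\mathfrak x)(y)\big)\otimes(\ell\mathfrak y)(z)\le\ell(\Sigma_X\mathfrak X)(z)$ for all $\mathfrak X\in\mathsf U\mathsf UX$, $\mathfrak y\in\mathsf UX$, $z\in X$. A morphism $f:(X,\ell)\to(Y,\ell')$ is a map with $(\ell\mathfrak x)(y)\le(\ell' f[\mathfrak x])(f(y))$ for all $\mathfrak x\in\mathsf UX$, $y\in X$. *)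

(* Defs.v *)
From HB Require Import structures.
From mathcomp Require Import all_boot all_order.
From mathcomp Require Import monoid boolp classical_sets filter.

Set Implicit Arguments.
Unset Strict Implicit.
Unset Printing Implicit Defensive.

Local Open Scope classical_set_scope.

HB.mixin Record TBLattice_isComplete (d : Order.disp_t) T
    of Order.TBLattice d T := {
  bigsup : set T -> T;
  bigsup_supremum : forall A : set T, supremums A (bigsup A)
}.

#[short(type="completeLatticeType")]
HB.structure Definition CompleteLattice (d : Order.disp_t) :=
  {T of TBLattice_isComplete d T & Order.TBLattice d T}.

Definition biginf (d : Order.disp_t) (L : completeLatticeType d) (A : set L) : L :=
  bigsup (lbound A).

Lemma biginf_infimum (d : Order.disp_t) (L : completeLatticeType d) (A : set L) :
  infimums A (biginf A).
Proof.
have [ub lub] := bigsup_supremum (lbound A).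
split=> [x Ax|x lbx]; last exact: ub.
by apply: lub => y lby; exact: lby.
Qed.

Definition completely_distributive (d : Order.disp_t) (L : completeLatticeType d) :=
  forall (I : Type) (J : I -> Type) (a : forall i, J i -> L),
    biginf [set bigsup [set a i j | j in [set: J i]] | i in [set: I]] =
    bigsup [set biginf [set a i (s i) | i in [set: I]]
           | s in [set: forall i, J i]].

(* The tensor and its unit [k] are the product and the unit of the library's
   monoids, written [x * y] and [1] in [group_scope]. *)
HB.mixin Record Monoid_CompleteLattice_isQuantale (d : Order.disp_t) T
    of monoid.Monoid T & CompleteLattice d T := {
  mulg_bigsupl : forall (A : set T) (y : T),
    (bigsup A * y)%g = bigsup [set (x * y)%g | x in A];
  mulg_bigsupr : forall (x : T) (A : set T),
    (x * bigsup A)%g = bigsup [set (x * y)%g | y in A]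
}.

#[short(type="quantaleType")]
HB.structure Definition Quantale (d : Order.disp_t) :=
  {T of Monoid_CompleteLattice_isQuantale d T
      & monoid.Monoid T & CompleteLattice d T}.

Record category := Category {
  obj :> Type;
  hom : obj -> obj -> Type;
  idm : forall X, hom X X;
  comp : forall X Y Z, hom Y Z -> hom X Y -> hom X Z;
  comp1m : forall X Y (f : hom X Y), comp (idm Y) f = f;
  compm1 : forall X Y (f : hom X Y), comp f (idm X) = f;
  compA : forall X Y Z W (h : hom Z W) (g : hom Y Z) (f : hom X Y),
    comp h (comp g f) = comp (comp h g) f
}.
Arguments hom {c} X Y.
Arguments idm {c} X.
Arguments comp {c X Y Z} g f.

Record functor (C D : category) := Functor {
  fobj :> C -> D;
  fhom : forall X Y : C, hom X Y -> hom (fobj X) (fobj Y);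
  fhom1 : forall X : C, fhom (idm X) = idm (fobj X);
  fhomM : forall (X Y Z : C) (g : hom Y Z) (f : hom X Y),
    fhom (comp g f) = comp (fhom g) (fhom f)
}.
Arguments fhom {C D} F {X Y} : rename.

Definition faithful (C D : category) (F : functor C D) :=
  forall X Y : C, injective (@fhom C D F X Y).

Definition full (C D : category) (F : functor C D) :=
  forall (X Y : C) (g : hom (F X) (F Y)), exists f : hom X Y, fhom F f = g.

Definition embedding (C D : category) (F : functor C D) :=
  faithful F /\ injective (fobj F).

Record adjunction (C D : category) (F : functor C D) (G : functor D C) := Adjunction {
  unit_ : forall X : C, hom X (G (F X));
  counit : forall Y : D, hom (F (G Y)) Y;
  unit_nat : forall (X X' : C) (f : hom X X'),
    comp (unit_ X') f = comp (fhom G (fhom F f)) (unit_ X);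
  counit_nat : forall (Y Y' : D) (g : hom Y Y'),
    comp g (counit Y) = comp (counit Y') (fhom F (fhom G g));
  triangleL : forall X : C, comp (counit (F X)) (fhom F (unit_ X)) = idm (F X);
  triangleR : forall Y : D, comp (fhom G (counit Y)) (unit_ (G Y)) = idm (G Y)
}.

(* For an embedding [F], this says that its image is coreflective. *)
Definition has_right_adjoint (C D : category) (F : functor C D) :=
  exists G : functor D C, inhabited (adjunction F G).

Record subcategory (C : category) := Subcategory {
  sub_obj : C -> Prop;
  sub_hom : forall X Y : C, hom X Y -> Prop;
  sub_hom_obj : forall (X Y : C) (f : hom X Y),
    sub_hom f -> sub_obj X /\ sub_obj Y;
  sub_id : forall X : C, sub_obj X -> sub_hom (idm X);
  sub_comp : forall (X Y Z : C) (g : hom Y Z) (f : hom X Y),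
    sub_hom g -> sub_hom f -> sub_hom (comp g f)
}.

Section FullSubcategory.
Variables (C : category) (P : C -> Prop).

Let in_full (X Y : C) (_ : hom X Y) := P X /\ P Y.

Let in_full_id (X : C) : P X -> in_full (idm X).
Proof. by []. Qed.

Let in_full_comp (X Y Z : C) (g : hom Y Z) (f : hom X Y) :
  in_full g -> in_full f -> in_full (comp g f).
Proof. by move=> [_ PZ] [PX _]. Qed.

Definition full_subcategory : subcategory C :=
  @Subcategory C P in_full (fun _ _ _ => id) in_full_id in_full_comp.
End FullSubcategory.

Variant image_hom (C D : category) (F : functor C D) :
    forall Y Z : D, hom Y Z -> Prop :=
  ImageHom (X X' : C) (g : hom X X') : @image_hom C D F (F X) (F X') (fhom F g).

Definition has_image (C D : category) (F : functor C D) (S : subcategory D) :=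
  (forall Y : D, (exists X : C, F X = Y) <-> sub_obj S Y) /\
  (forall (Y Z : D) (g : hom Y Z), image_hom F g <-> sub_hom S g).

Record ultrafilter (X : Type) := Ultrafilter {
  ultra_sets : set_system X;
  ultra_setsP : UltraFilter ultra_sets
}.

Section Ultrafilters.
Variables X Y : Type.

Lemma ultrafilter_proper (F : ultrafilter X) : ProperFilter (ultra_sets F).
Proof. by case: F => F /= [? _]. Qed.

Lemma ultrafilter_setVsetC (F : ultrafilter X) (A : set X) :
  ultra_sets F A \/ ultra_sets F (~` A).
Proof. exact: in_ultra_setVsetC (ultra_setsP F). Qed.

Lemma setVsetC_ultra (F : set_system X) : ProperFilter F ->
  (forall A, F A \/ F (~` A)) -> UltraFilter F.
Proof.
move=> PF FVC; split=> // G PG sFG; apply/seteqP; split=> // A GA.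
have [//|/sFG GCA] := FVC A; exfalso.
by apply: (@filter_not_empty _ G); rewrite -(setICr A); exact: filterI.
Qed.
End Ultrafilters.

Definition principal_ultra (X : Type) (x : X) : ultrafilter X :=
  Ultrafilter (principal_filter_ultra x).

Section ImageAndSum.
Variables (X Y : Type).

Lemma ultra_image_subproof (f : X -> Y) (F : ultrafilter X) :
  UltraFilter [set B : set Y | ultra_sets F (f @^-1` B)].
Proof.
have PF := ultrafilter_proper F.
by apply: setVsetC_ultra => B; exact: ultrafilter_setVsetC.
Qed.

Definition ultra_map (f : X -> Y) (F : ultrafilter X) : ultrafilter Y :=
  Ultrafilter (ultra_image_subproof f F).

Lemma ultra_sum_subproof (FF : ultrafilter (ultrafilter X)) :
  UltraFilter [set A : set X |
    ultra_sets FF [set F : ultrafilter X | ultra_sets F A]].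
Proof.
have PFF := ultrafilter_proper FF.
have FFF : Filter (ultra_sets FF) by exact: filter_filter.
apply: setVsetC_ultra => [|A] /=; last first.
  have [FA|FCA] := ultrafilter_setVsetC FF [set F | ultra_sets F A]; [by left|right].
  apply: filterS FCA => F /= nFA.
  by have [] := ultrafilter_setVsetC F A.
split=> /=.
  move=> FF0; apply: (@filter_not_empty _ _ PFF); apply: filterS FF0 => F /= F0.
  exact: (@filter_not_empty _ _ (ultrafilter_proper F)).
split=> [|A B FA FB|A B sAB FA] /=.
- apply: (@filterS _ _ FFF setT) => [F _ /=|]; last exact: (@filterT _ _ FFF).
  have PF := ultrafilter_proper F; exact: filterT.
- apply: (@filterS _ _ FFF _ _ _ (@filterI _ _ FFF _ _ FA FB)) => F [/= ? ?].
  have PF := ultrafilter_proper F; exact: filterI.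
- apply: (@filterS _ _ FFF _ _ _ FA) => F /=.
  have PF := ultrafilter_proper F; exact: filterS.
Qed.

Definition ultra_sum (FF : ultrafilter (ultrafilter X)) : ultrafilter X :=
  Ultrafilter (ultra_sum_subproof FF).
End ImageAndSum.

Section Spaces.
Variables (d : Order.disp_t) (V : quantaleType d).

Definition closure_axioms (X : Type) (c : set X -> X -> V) :=
  (forall x : X, (1%g <= c [set x] x)%O) /\
  (forall (AA : set (set X)) (B : set X) (z : X),
     (biginf [set bigsup [set c A y | A in AA] | y in B] * c B z
        <= c (\bigcup_(A in AA) A) z)%g%O).

Record closure_space := ClosureSpace {
  cls_set :> Type;
  cls_op : set cls_set -> cls_set -> V;
  cls_opP : closure_axioms cls_op
}.

Definition contractive (X Y : Type) (c : set X -> X -> V) (c' : set Y -> Y -> V)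
    (f : X -> Y) :=
  forall (A : set X) (x : X), (c A x <= c' (f @` A) (f x))%O.

Record cls_hom (X Y : closure_space) := ClsHom {
  cls_map :> X -> Y;
  cls_mapP : contractive (@cls_op X) (@cls_op Y) cls_map
}.

Lemma cls_hom_eq (X Y : closure_space) (f g : cls_hom X Y) :
  cls_map f = cls_map g -> f = g.
Proof.
case: f g => f fP [g gP] /= fg; rewrite fg in fP *.
by rewrite (Prop_irrelevance fP gP).
Qed.

Let cls_id_subproof (X : closure_space) :
  contractive (@cls_op X) (@cls_op X) idfun.
Proof. by move=> A x; rewrite image_id. Qed.

Let cls_comp_subproof (X Y Z : closure_space) (g : cls_hom Y Z) (f : cls_hom X Y) :
  contractive (@cls_op X) (@cls_op Z) (g \o f).
Proof.
move=> A x; rewrite -image_comp.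
exact: Order.POrderTheory.le_trans (cls_mapP f A x) (cls_mapP g _ _).
Qed.

Definition cls_id (X : closure_space) : cls_hom X X := ClsHom (@cls_id_subproof X).

Definition cls_comp (X Y Z : closure_space) (g : cls_hom Y Z) (f : cls_hom X Y) :
  cls_hom X Z := ClsHom (cls_comp_subproof g f).

Let cls_comp1m (X Y : closure_space) (f : cls_hom X Y) : cls_comp (cls_id Y) f = f.
Proof. exact: cls_hom_eq. Qed.

Let cls_compm1 (X Y : closure_space) (f : cls_hom X Y) : cls_comp f (cls_id X) = f.
Proof. exact: cls_hom_eq. Qed.

Let cls_compA (X Y Z W : closure_space)
    (h : cls_hom Z W) (g : cls_hom Y Z) (f : cls_hom X Y) :
  cls_comp h (cls_comp g f) = cls_comp (cls_comp h g) f.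
Proof. exact: cls_hom_eq. Qed.

Definition Cls : category := Category cls_comp1m cls_compm1 cls_compA.

Definition approach_axioms (X : Type) (c : set X -> X -> V) :=
  (forall x : X, c set0 x = Order.bottom) /\
  (forall (A B : set X) (x : X), c (A `|` B) x = Order.join (c A x) (c B x)).

Definition App : subcategory Cls :=
  full_subcategory (fun X : Cls => approach_axioms (@cls_op X)).

Definition alg_axioms (X : Type) (l : ultrafilter X -> X -> V) :=
  (forall x : X, (1%g <= l (principal_ultra x) x)%O) /\
  (forall (XX : ultrafilter (ultrafilter X)) (yy : ultrafilter X) (z : X),
     (biginf [set bigsup [set l xx y | xx in A & y in B]
             | A in ultra_sets XX & B in ultra_sets yy] * l yy z
        <= l (ultra_sum XX) z)%g%O).

Record beta_alg := BetaAlg {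
  alg_set :> Type;
  alg_op : ultrafilter alg_set -> alg_set -> V;
  alg_opP : alg_axioms alg_op
}.

Record alg_hom (X Y : beta_alg) := AlgHom {
  alg_map :> X -> Y;
  alg_mapP : forall (xx : ultrafilter X) (y : X),
    (alg_op xx y <= alg_op (ultra_map alg_map xx) (alg_map y))%O
}.

Lemma ultrafilter_eq (X : Type) (F G : ultrafilter X) :
  ultra_sets F = ultra_sets G -> F = G.
Proof.
case: F G => F FP [G GP] /= FG; rewrite FG in FP *.
by rewrite (Prop_irrelevance FP GP).
Qed.

Lemma alg_hom_eq (X Y : beta_alg) (f g : alg_hom X Y) :
  alg_map f = alg_map g -> f = g.
Proof.
case: f g => f fP [g gP] /= fg; rewrite fg in fP *.
by rewrite (Prop_irrelevance fP gP).
Qed.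

Let alg_id_subproof (X : beta_alg) (xx : ultrafilter X) (y : X) :
  (alg_op xx y <= alg_op (ultra_map idfun xx) y)%O.
Proof. by rewrite (_ : ultra_map idfun xx = xx) //; exact: ultrafilter_eq. Qed.

Let alg_comp_subproof (X Y Z : beta_alg) (g : alg_hom Y Z) (f : alg_hom X Y)
    (xx : ultrafilter X) (y : X) :
  (alg_op xx y <= alg_op (ultra_map (g \o f) xx) ((g \o f) y))%O.
Proof.
have -> : ultra_map (g \o f) xx = ultra_map g (ultra_map f xx).
  exact: ultrafilter_eq.
exact: Order.POrderTheory.le_trans (alg_mapP f xx y) (alg_mapP g _ _).
Qed.

Definition alg_id (X : beta_alg) : alg_hom X X :=
  @AlgHom X X idfun (@alg_id_subproof X).

Definition alg_comp (X Y Z : beta_alg) (g : alg_hom Y Z) (f : alg_hom X Y) :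
  alg_hom X Z := AlgHom (alg_comp_subproof g f).

Let alg_comp1m (X Y : beta_alg) (f : alg_hom X Y) : alg_comp (alg_id Y) f = f.
Proof. exact: alg_hom_eq. Qed.

Let alg_compm1 (X Y : beta_alg) (f : alg_hom X Y) : alg_comp f (alg_id X) = f.
Proof. exact: alg_hom_eq. Qed.

Let alg_compA (X Y Z W : beta_alg)
    (h : alg_hom Z W) (g : alg_hom Y Z) (f : alg_hom X Y) :
  alg_comp h (alg_comp g f) = alg_comp (alg_comp h g) f.
Proof. exact: alg_hom_eq. Qed.

Definition Alg : category := Category alg_comp1m alg_compm1 alg_compA.

Definition closure_of (X : Type) (l : ultrafilter X -> X -> V)
    (A : set X) (x : X) : V :=
  bigsup [set l xx x | xx in [set xx : ultrafilter X | ultra_sets xx A]].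

(* That the assignment sends objects to objects and morphisms to morphisms is
   part of the theorem, hence taken here as the hypotheses [objP] and [homP]. *)
Definition A_eps_objP :=
  forall X : beta_alg, closure_axioms (closure_of (@alg_op X)).

Definition A_eps_homP :=
  forall (X Y : beta_alg) (f : alg_hom X Y),
    contractive (closure_of (@alg_op X)) (closure_of (@alg_op Y)) f.

Section AEps.
Variables (objP : A_eps_objP) (homP : A_eps_homP).

Definition A_eps_obj (X : Alg) : Cls := ClosureSpace (objP X).

Definition A_eps_hom (X Y : Alg) (f : hom X Y) : hom (A_eps_obj X) (A_eps_obj Y) :=
  @ClsHom (A_eps_obj X) (A_eps_obj Y) (alg_map f) (@homP X Y f).

Let A_eps_id (X : Alg) : A_eps_hom (idm X) = idm (A_eps_obj X).
Proof. exact: cls_hom_eq. Qed.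

Let A_eps_comp (X Y Z : Alg) (g : hom Y Z) (f : hom X Y) :
  A_eps_hom (comp g f) = comp (A_eps_hom g) (A_eps_hom f).
Proof. exact: cls_hom_eq. Qed.

Definition A_eps : functor Alg Cls := Functor A_eps_id A_eps_comp.
End AEps.
End Spaces.

(* Main.v *)
(** Write [u <<< v] ([totally_below]) when every set whose supremum dominates
    [v] has an element above [u].  By complete distributivity every [v] is the
    supremum of the [u <<< v], and [<<<] interpolates.  The inverse of
    [l |-> c_l] is [c |-> l_c], [l_c(xx)(x) = inf_(A in xx) c(A)(x)].

    - [l_(c_l) = l]: if [u <<< l_(c_l)(xx)(x)], the ultrafilters [xx'] with
      [u <= l(xx')(x)] and [A \in xx'], for [A \in xx], generate a proper
      filter on [UX]; an ultrafilter [XX] refining it satisfies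
      [Sigma XX = xx], and (T'') at the principal ultrafilter of [x] gives
      [u <= l(xx)(x)].
    - [c_(l_c) = c] for an approach space [c]: if [u <<< c(A)(x)], the sets [B]
      with [~ u <<< c(B)(x)] form an ideal that does not contain [A], hence
      some ultrafilter containing [A] avoids it.

    For an arbitrary closure space [c], [l_c] is still a [(beta,V)]-algebra and
    [c_(l_c) <= c]; this gives the coreflection. *)
Require Import Defs.
From mathcomp Require Import all_boot all_order.
From mathcomp Require Import monoid boolp classical_sets filter.

Set Implicit Arguments.
Unset Strict Implicit.
Unset Printing Implicit Defensive.

Import Order.Theory.
Local Open Scope classical_set_scope.

(** * The totally-below relation in a completely distributive lattice *)

Section CompleteLattice.
Variables (d : Order.disp_t) (L : completeLatticeType d).
Implicit Types (A : set L) (x y u v : L).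

Lemma le_bigsup A x : A x -> (x <= bigsup A)%O.
Proof. exact: (bigsup_supremum A).1. Qed.

Lemma ge_bigsup A y : (forall x, A x -> (x <= y)%O) -> (bigsup A <= y)%O.
Proof. exact: (bigsup_supremum A).2. Qed.

Lemma biginf_le A x : A x -> (biginf A <= x)%O.
Proof. exact: (biginf_infimum A).1. Qed.

Lemma le_biginf A y : (forall x, A x -> (y <= x)%O) -> (y <= biginf A)%O.
Proof. exact: (biginf_infimum A).2. Qed.

Definition totally_below u v :=
  forall A, (v <= bigsup A)%O -> exists2 a, A a & (u <= a)%O.

Lemma totally_below_le u v w :
  totally_below u v -> (v <= w)%O -> totally_below u w.
Proof. by move=> uv vw A wA; apply: uv; exact: le_trans wA. Qed.

Lemma le_totally_below u v w :
  (u <= v)%O -> totally_below v w -> totally_below u w.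
Proof.
by move=> uv vw A /vw[a Aa va]; exists a => //; exact: le_trans va.
Qed.

Lemma totally_belowW u v : totally_below u v -> (u <= v)%O.
Proof.
case/(_ [set v]) => [|a -> //].
exact: le_bigsup.
Qed.

Lemma not_totally_below0 u : ~ totally_below u \bot%O.
Proof. by case/(_ set0 (le0x _)) => a []. Qed.

Hypothesis cdL : completely_distributive L.

(** Complete distributivity is applied to the family of all sets whose supremum dominates [v], each
    indexed by its own elements. The infimum over a choice function [s] lies below an element of
    every such set, so it is totally below [v]. *)
Lemma bigsup_totally_below v : bigsup [set u | totally_below u v] = v.
Proof.
apply/le_anti/andP; split; first by apply: ge_bigsup => u /totally_belowW.
pose I := {A : set L | (v <= bigsup A)%O}.
have cd := cdL (fun (i : I) (j : {a | sval i a}) => sval j).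
apply: (@le_trans _ _ (biginf
    [set bigsup [set sval j | j in [set: {a | sval i a}]] | i in [set: I]])).
  apply: le_biginf => _ [[A vA] _ <-] /=; apply: le_trans vA _.
  by apply: ge_bigsup => a Aa; apply: le_bigsup; exists (exist _ a Aa).
rewrite cd; apply: ge_bigsup => _ [s _ <-]; apply: le_bigsup => A vA.
exists (sval (s (exist _ A vA))); first exact: (svalP (s (exist _ A vA))).
by apply: biginf_le; exists (exist _ A vA).
Qed.

Lemma le_from_below v w :
  (forall u, totally_below u v -> (u <= w)%O) -> (v <= w)%O.
Proof. by move=> vw; rewrite -(bigsup_totally_below v); exact: ge_bigsup. Qed.

(** Two uses of [le_from_below] show that the [t] with [t <<< v <<< w] for some [v] have supremum at
    least [w], so one of them dominates [u]. *)
Lemma totally_below_interpolate u w :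
  totally_below u w -> exists2 v, totally_below u v & totally_below v w.
Proof.
move=> uw.
case: (uw [set t | exists2 v, totally_below t v & totally_below v w]).
  apply: le_from_below => v vw; apply: le_from_below => t tv.
  by apply: le_bigsup; exists v.
by move=> t [v tv vw] ut; exists v => //; exact: le_totally_below tv.
Qed.

Lemma totally_below_join u v w : totally_below u (Order.join v w) ->
  totally_below u v \/ totally_below u w.
Proof.
(* Testing [u] directly against the set of [v] and [w] would give only [u <= v] or [u <= w]; the
   interpolant [t] keeps the relation strict. *)
move=> /totally_below_interpolate[t ut tvw].
have [|a [->|->] ta] := tvw [set v; w].
- by rewrite leUx !le_bigsup //; [right|left].
- by left; exact: totally_below_le ta.
- by right; exact: totally_below_le ta.
Qed.

End CompleteLattice.

(** * Monotonicity of the tensor, from preservation of suprema *)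

Section QuantaleMonotonicity.
Variables (d : Order.disp_t) (V : quantaleType d).
Implicit Types x y z : V.

Lemma bigsup_pair x y : (x <= y)%O -> bigsup [set x; y] = y.
Proof.
move=> xy; apply/le_anti/andP; split; last by apply: le_bigsup; right.
by apply: ge_bigsup => _ [->|->].
Qed.

Lemma mulg_mono x x' y y' :
  (x <= x')%O -> (y <= y')%O -> (x * y <= x' * y')%g%O.
Proof.
move=> xx' yy'; apply: (@le_trans _ _ (x' * y)%g).
  rewrite -(bigsup_pair xx') mulg_bigsupl; apply: le_bigsup.
  by exists x => //; left.
rewrite -(bigsup_pair yy') mulg_bigsupr; apply: le_bigsup.
by exists y => //; left.
Qed.

Hypothesis cdV : completely_distributive V.

Lemma mulg_le_from_below x y z :
  (forall u, totally_below u x -> (u * y <= z)%g%O) -> (x * y <= z)%g%O.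
Proof.
move=> le_z; rewrite -(bigsup_totally_below cdV x) mulg_bigsupl.
by apply: ge_bigsup => _ [u /le_z ? <-].
Qed.

End QuantaleMonotonicity.

(** * Existence of ultrafilters *)

Section Ultrafilters.
Variable X : Type.
Implicit Types (xx : ultrafilter X) (A B : set X).

Lemma ultra_setI xx A B :
  ultra_sets xx A -> ultra_sets xx B -> ultra_sets xx (A `&` B).
Proof. by have PF := ultrafilter_proper xx; exact: filterI. Qed.

Lemma ultra_setS xx A B : A `<=` B -> ultra_sets xx A -> ultra_sets xx B.
Proof. by have PF := ultrafilter_proper xx; exact: filterS. Qed.

Lemma ultra_set_ex xx A : ultra_sets xx A -> exists x, A x.
Proof. by have PF := ultrafilter_proper xx; exact: filter_ex. Qed.

Lemma ultra_setT xx : ultra_sets xx setT.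
Proof. by have PF := ultrafilter_proper xx; exact: filterT. Qed.

Lemma ultra_meet xx A :
  (forall B, ultra_sets xx B -> exists2 x, B x & A x) -> ultra_sets xx A.
Proof.
move=> meetA; have [//|/meetA[x nAx Ax]] := ultrafilter_setVsetC xx A.
by case: (nAx Ax).
Qed.

Lemma ultra_ext xx yy : (forall A, ultra_sets xx A -> ultra_sets yy A) ->
  xx = yy.
Proof.
move=> sxy; apply: ultrafilter_eq; apply/seteqP; split=> // A yyA.
apply: ultra_meet => B /sxy yyB.
by have [x []] := ultra_set_ex (ultra_setI yyA yyB); exists x.
Qed.

Lemma ultra_extend (T : Type) (F : set_system T) : ProperFilter F ->
  exists xx : ultrafilter T, F `<=` ultra_sets xx.
Proof.
by move=> /ultraFilterLemma[G [GU sFG]]; exists (Ultrafilter GU).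
Qed.

(** The ultrafilter form of the prime ideal theorem: the sets that cover [A] up to a member of the
    ideal [J] form a filter, proper because [A] is outside [J]. *)
Lemma ultra_avoid (J : set (set X)) A :
    J set0 -> (forall B C, J B -> J C -> J (B `|` C)) ->
    (forall B C, B `<=` C -> J C -> J B) -> ~ J A ->
  exists2 xx, ultra_sets xx A & forall B, ultra_sets xx B -> ~ J B.
Proof.
move=> J0 JU JS nJA.
have FJ : ProperFilter [set B | J (A `&` ~` B)].
  split; first by rewrite /= setC0 setIT.
  split=> [|B C JB JC|B C sBC] /=; first by rewrite setCT setI0.
    by rewrite setCI setIUr; exact: JU.
  by apply: JS; apply: setIS; exact: subsetC.
have [xx sFxx] := ultra_extend FJ; exists xx.
  by apply: sFxx; rewrite /= setICr.
move=> B xxB JB.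
have xxCB : ultra_sets xx (~` B).
  by apply: sFxx; rewrite /= setCK; apply: JS JB; exact: subIsetr.
by have [x []] := ultra_set_ex (ultra_setI xxB xxCB).
Qed.

(** The hypothesis makes the traces on [S] of the sets of ultrafilters containing [A], for [A] in
    [xx], a base of a proper filter. Any ultrafilter refining it has a sum containing [xx], hence
    equal to [xx]. *)
Lemma ultra_sum_lift xx (S : set (ultrafilter X)) :
    (forall A, ultra_sets xx A -> exists2 yy, S yy & ultra_sets yy A) ->
  exists2 XX, ultra_sets XX S & ultra_sum XX = xx.
Proof.
move=> Sxx.
pose F := filter_from (ultra_sets xx) (fun A => S `&` [set yy | ultra_sets yy A]).
have PF : ProperFilter F.
  apply: filter_from_proper.
    apply: filter_from_filter; first by exists setT; exact: ultra_setT.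
    move=> A B xxA xxB; exists (A `&` B); first exact: ultra_setI.
    by move=> yy [Syy /= yyAB]; split; split=> //=;
      apply: ultra_setS yyAB; [exact: subIsetl|exact: subIsetr].
  by move=> A /Sxx[yy]; exists yy.
have [XX sFXX] := ultra_extend PF; exists XX.
  by apply: sFXX; exists setT; [exact: ultra_setT|exact: subIsetl].
by apply/esym/ultra_ext => A xxA; apply: sFXX; exists A => //; exact: subIsetr.
Qed.

End Ultrafilters.

(** * Passing between closure and ultrafilter convergence on one set *)

Section ClosureAndLimit.
Variables (d : Order.disp_t) (V : quantaleType d).

Definition limit_of (X : Type) (c : set X -> X -> V)
    (xx : ultrafilter X) (x : X) : V :=
  biginf [set c A x | A in ultra_sets xx].

Section OneSet.
Variable X : Type.
Implicit Types (c : set X -> X -> V) (l : ultrafilter X -> X -> V).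

Lemma le_closure_of l xx A x :
  ultra_sets xx A -> (l xx x <= closure_of l A x)%O.
Proof. by move=> xxA; apply: le_bigsup; exists xx. Qed.

Lemma limit_of_le c xx A x : ultra_sets xx A -> (limit_of c xx x <= c A x)%O.
Proof. by move=> xxA; apply: biginf_le; exists A. Qed.

Lemma closure_limit_le c A x : (closure_of (limit_of c) A x <= c A x)%O.
Proof. by apply: ge_bigsup => _ [xx /= xxA <-]; exact: limit_of_le. Qed.

Lemma le_limit_closure l xx x : (l xx x <= limit_of (closure_of l) xx x)%O.
Proof. by apply: le_biginf => _ [A xxA <-]; exact: le_closure_of. Qed.

Lemma closure_of_approach l : approach_axioms (closure_of l).
Proof.
split=> [x|A B x].
  apply/le_anti; rewrite le0x andbT.
  by apply: ge_bigsup => _ [xx /= /ultra_set_ex[? []] _].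
apply/le_anti/andP; split.
  apply: ge_bigsup => _ [xx /= xxAB <-].
  have [xxA|xxCA] := ultrafilter_setVsetC xx A.
    by apply: lexU2; rewrite le_closure_of.
  apply: lexU2; rewrite [X in _ || X]le_closure_of ?orbT //.
  by apply: ultra_setS (ultra_setI xxAB xxCA) => y [[]].
rewrite leUx; apply/andP; split; apply: ge_bigsup => _ [xx /= xxA <-];
  apply: le_closure_of; apply: ultra_setS xxA; [exact: subsetUl|exact: subsetUr].
Qed.

(** (T') is applied to the singletons of points of [B], whose union is [B]; by (R') its first factor
    is at least the unit. *)
Lemma closure_axioms_mono c A B x :
  closure_axioms c -> A `<=` B -> (c A x <= c B x)%O.
Proof.
move=> [cR cT] sAB.
have := cT [set [set a] | a in B] A x.
rewrite bigcup_image bigcup_imset1 image_id; apply: le_trans.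
rewrite -{1}(mul1g (c A x)); apply: mulg_mono => //.
apply: le_biginf => _ [y Ay <-]; apply: (le_trans (cR y)).
by apply: le_bigsup; exists [set y] => //; exists y => //; exact: sAB.
Qed.

Hypothesis cdV : completely_distributive V.

(** For [u] totally below the infimum, each [y] in [B] gets an ultrafilter [g y] containing the
    union [U] with [u <= l (g y) y]. (T'') then applies to the image of [yy] under [g], whose sum
    contains [U]. *)
Lemma closure_of_axioms l : alg_axioms l -> closure_axioms (closure_of l).
Proof.
move=> [lR lT]; split=> [x|AA B z].
  exact: le_trans (lR x) (le_closure_of _ _ _).
rewrite {2}/closure_of mulg_bigsupr; apply: ge_bigsup.
move=> _ [_ [yy /= yyB <-] <-]; apply: mulg_le_from_below => // u u_inf.
set U := \bigcup_(A in AA) A.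
have /choice[g gP] : forall y, exists xx,
    B y -> ultra_sets xx U /\ (u <= l xx y)%O.
  (* Outside [B] nothing is required of the chosen ultrafilter, and [yy] is a default. *)
  move=> y; have [By|] := pselect (B y); last by exists yy.
  case: (u_inf [set l xx y | xx in [set xx | ultra_sets xx U]]).
    apply: (@le_trans _ _ (bigsup [set closure_of l A y | A in AA])).
      by apply: biginf_le; exists y.
    apply: ge_bigsup => _ [A AAA <-]; apply: ge_bigsup => _ [xx /= xxA <-].
    by apply: le_closure_of; apply: ultra_setS xxA => t At; exists A.
  by move=> _ [xx /= xxU <-] u_le; exists xx.
apply: le_trans (le_closure_of l z (_ : ultra_sets (ultra_sum (ultra_map g yy)) U)).
  apply: le_trans (lT _ _ _); apply: mulg_mono => //.
  apply: le_biginf => _ [A yyA [B' yyB' <-]].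
  have {}yyA : ultra_sets yy (g @^-1` A) := yyA.
  have [y [[gAy B'y] By]] := ultra_set_ex (ultra_setI (ultra_setI yyA yyB') yyB).
  apply: le_trans (gP y By).2 _.
  by apply: le_bigsup; exists (g y) => //; exists y.
by apply: ultra_setS yyB => y /gP[].
Qed.

(** For [A] in the sum of [XX], the ultrafilters containing [A] form a member of [XX]. Evaluating
    the infimum there shows that the set [B] of points with [u <= c A y] meets every member of [yy],
    so it belongs to [yy]; (T') for the single set [A] and [B] concludes. *)
Lemma limit_of_axioms c : closure_axioms c -> alg_axioms (limit_of c).
Proof.
move=> cP; have [cR cT] := cP; split=> [x|XX yy z].
  apply: le_biginf => _ [A xA <-]; apply: le_trans (cR x) _.
  by apply: closure_axioms_mono => // _ ->.
apply: le_biginf => _ [A XXA <-].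
apply: mulg_le_from_below => // u u_inf.
pose B := [set y | (u <= c A y)%O].
have yyB : ultra_sets yy B.
  apply: ultra_meet => B' yyB'.
  case: (u_inf [set c A y | y in B']).
    apply: (le_trans (biginf_le _)); first by exists [set xx | ultra_sets xx A] => //; exists B'.
    apply: ge_bigsup => _ [xx xxA [y B'y <-]].
    by apply: le_trans (limit_of_le c y xxA) (le_bigsup _); exists y.
  by move=> _ [y B'y <-] u_le; exists y.
have := cT [set A] B z; rewrite bigcup_set1; apply: le_trans.
apply: mulg_mono; last exact: limit_of_le.
apply: le_biginf => _ [y By <-]; apply: le_trans By _.
by apply: le_bigsup; exists A.
Qed.

Lemma limit_closureK l : alg_axioms l -> limit_of (closure_of l) = l.
Proof.
move=> [lR lT]; apply/funext => xx; apply/funext => x.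
apply/le_anti; rewrite le_limit_closure andbT.
apply: le_from_below => // u u_inf.
have [A xxA|XX XXS <-] := @ultra_sum_lift _ xx [set yy | (u <= l yy x)%O].
  case: (u_inf [set l yy x | yy in [set yy | ultra_sets yy A]]).
    exact: limit_of_le.
  by move=> _ [yy /= yyA <-] u_le; exists yy.
(* By (R''), the unit factor is below [l (principal_ultra x) x]. *)
apply: le_trans (lT XX (principal_ultra x) x); rewrite -[leLHS]mulg1.
apply: mulg_mono (lR x); apply: le_biginf => _ [A XXA [B Bx <-]].
have [yy [Ayy u_le]] := ultra_set_ex (ultra_setI XXA XXS).
by apply: le_trans u_le (le_bigsup _); exists yy => //; exists x => //; exact: Bx.
Qed.

Lemma closure_limitK c : approach_axioms c -> closure_of (limit_of c) = c.
Proof.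
move=> [c0 cU]; apply/funext => A; apply/funext => x.
apply/le_anti; rewrite closure_limit_le /=.
apply: le_from_below => // u u_cA.
have [||||xx xxA xxP] := @ultra_avoid _ [set B | ~ totally_below u (c B x)] A.
- by rewrite /= c0; exact: not_totally_below0.
- by move=> B C /= nB nC; rewrite cU => /(totally_below_join cdV)[].
- move=> B C sBC /= nC u_cB; apply: nC; apply: totally_below_le u_cB _.
  (* Monotonicity of [c] is read off from additivity. *)
  by rewrite -((setUidPr _ _).2 sBC) cU leUl.
- by apply.
apply: le_trans (le_closure_of _ _ xxA); apply: le_biginf => _ [B xxB <-].
by apply: totally_belowW; apply: contrapT; exact: (xxP B xxB).
Qed.

End OneSet.

Lemma closure_of_contractive (X Y : Type) (l : ultrafilter X -> X -> V)
    (l' : ultrafilter Y -> Y -> V) (f : X -> Y) :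
    (forall xx y, (l xx y <= l' (ultra_map f xx) (f y))%O) ->
  contractive (closure_of l) (closure_of l') f.
Proof.
move=> fP A x; apply: ge_bigsup => _ [xx /= xxA <-].
apply: le_trans (fP xx x) (le_closure_of _ _ _).
by apply: ultra_setS xxA; exact: preimage_image.
Qed.

Lemma limit_of_map (X Y : Type) (c : set X -> X -> V) (c' : set Y -> Y -> V)
    (f : X -> Y) :
    closure_axioms c' -> contractive c c' f ->
  forall xx y, (limit_of c xx y <= limit_of c' (ultra_map f xx) (f y))%O.
Proof.
move=> c'P fP xx y; apply: le_biginf => _ [B xxB <-].
apply: le_trans (limit_of_le c y xxB) (le_trans (fP _ _) _).
by apply: closure_axioms_mono => //; exact: image_preimage_subset.
Qed.

Lemma ultra_map_idfun (X : Type) (xx : ultrafilter X) : ultra_map idfun xx = xx.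
Proof. exact: ultrafilter_eq. Qed.

End ClosureAndLimit.

(** * The functors, the adjunction and the image *)

Section Coreflection.
Variables (d : Order.disp_t) (V : quantaleType d).
Hypothesis cdV : completely_distributive V.

Lemma A_eps_obj_axioms : A_eps_objP V.
Proof. by move=> X; apply: closure_of_axioms => //; exact: alg_opP. Qed.

Lemma A_eps_hom_contractive : A_eps_homP V.
Proof. by move=> X Y f; apply: closure_of_contractive; exact: alg_mapP. Qed.

Local Notation F := (A_eps A_eps_obj_axioms A_eps_hom_contractive).

Definition limit_obj (X : Cls V) : Alg V :=
  BetaAlg (limit_of_axioms cdV (@cls_opP _ _ X)).

Definition limit_hom (X Y : Cls V) (f : hom X Y) :
    hom (limit_obj X) (limit_obj Y) :=
  @AlgHom _ _ (limit_obj X) (limit_obj Y) (cls_map f)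
    (limit_of_map (@cls_opP _ _ Y) (cls_mapP f)).

Lemma limit_hom1 (X : Cls V) : limit_hom (idm X) = idm (limit_obj X).
Proof. exact: alg_hom_eq. Qed.

Lemma limit_homM (X Y Z : Cls V) (g : hom Y Z) (f : hom X Y) :
  limit_hom (Defs.comp g f) = Defs.comp (limit_hom g) (limit_hom f).
Proof. exact: alg_hom_eq. Qed.

Definition limit_functor : functor (Cls V) (Alg V) :=
  Functor limit_hom1 limit_homM.

Lemma closure_space_eq (X : Type) (c c' : set X -> X -> V)
    (cP : closure_axioms c) (c'P : closure_axioms c') :
  c = c' -> ClosureSpace cP = ClosureSpace c'P.
Proof. by move=> cc'; subst c'; rewrite (Prop_irrelevance cP c'P). Qed.

Lemma beta_alg_eq (X : Type) (l l' : ultrafilter X -> X -> V)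
    (lP : alg_axioms l) (l'P : alg_axioms l') :
  l = l' -> BetaAlg lP = BetaAlg l'P.
Proof. by move=> ll'; subst l'; rewrite (Prop_irrelevance lP l'P). Qed.

Lemma limit_objK (X : Alg V) : limit_obj (F X) = X.
Proof. by case: X => X l lP; apply: beta_alg_eq; exact: limit_closureK. Qed.

Lemma A_eps_objK (Y : Cls V) : approach_axioms (@cls_op _ _ Y) ->
  F (limit_obj Y) = Y.
Proof. by case: Y => Y c cP cA; apply: closure_space_eq; exact: closure_limitK. Qed.

Lemma A_eps_embedding : embedding F.
Proof.
split=> [X Y f g /(congr1 (@cls_map _ _ _ _)) fg|X Y FXY].
  exact: alg_hom_eq.
by rewrite -(limit_objK X) FXY limit_objK.
Qed.

(** A map contractive for the closures respects their limit operators, which by [limit_closureK] are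
    the original structures. *)
Lemma A_eps_full : full F.
Proof.
move=> X Y g.
have gP (xx : ultrafilter X) (y : X) :
    (alg_op xx y <= alg_op (ultra_map g xx) (g y : Y))%O.
  have := limit_of_map (@cls_opP _ _ (F Y)) (cls_mapP g) xx y.
  by rewrite /= !limit_closureK //; exact: alg_opP.
by exists (@AlgHom _ _ X Y g gP); exact: cls_hom_eq.
Qed.

Lemma limit_unit_subproof (X : Alg V) (xx : ultrafilter X) (y : X) :
  (alg_op xx y <= limit_of (closure_of (@alg_op _ _ X)) (ultra_map idfun xx) y)%O.
Proof. by rewrite ultra_map_idfun; exact: le_limit_closure. Qed.

Definition limit_unit (X : Alg V) : hom X (limit_functor (F X)) :=
  @AlgHom _ _ X (limit_obj (F X)) idfun (@limit_unit_subproof X).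

Lemma limit_counit_subproof (Y : Cls V) :
  contractive (closure_of (limit_of (@cls_op _ _ Y))) (@cls_op _ _ Y) idfun.
Proof. by move=> A x; rewrite image_id; exact: closure_limit_le. Qed.

Definition limit_counit (Y : Cls V) : hom (F (limit_functor Y)) Y :=
  @ClsHom _ _ (F (limit_obj Y)) Y idfun (@limit_counit_subproof Y).

(** Unit and counit are identities on points, so every required equation holds on underlying
    maps. *)
Lemma A_eps_has_right_adjoint : has_right_adjoint F.
Proof.
exists limit_functor; constructor.
apply: (@Adjunction _ _ F limit_functor limit_unit limit_counit).
- by move=> X X' f; exact: alg_hom_eq.
- by move=> Y Y' g; exact: cls_hom_eq.
- by move=> X; exact: cls_hom_eq.
- by move=> Y; exact: alg_hom_eq.
Qed.

Lemma A_eps_image : has_image F (App V).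
Proof.
split=> [Y|Y Z g]; split.
- by move=> [X <-]; exact: closure_of_approach.
- by move=> /A_eps_objK YA; exists (limit_obj Y).
- by move=> [X X' f]; split; exact: closure_of_approach.
- move=> [/A_eps_objK YA /A_eps_objK ZA].
  (* [image_hom] speaks only of morphisms between objects of the form [F X]; rewriting puts [g] in
     that form, and fullness applies. *)
  move: g; rewrite -YA -ZA => g.
  by have [f <-] := A_eps_full g; exact: ImageHom.
Qed.

End Coreflection.

Theorem theorem3p6 (d : Order.disp_t) (V : quantaleType d) :
  completely_distributive V ->
  exists (objP : A_eps_objP V) (homP : A_eps_homP V),
    embedding (A_eps objP homP) /\
    full (A_eps objP homP) /\
    has_right_adjoint (A_eps objP homP) /\
    has_image (A_eps objP homP) (App V).
Proof.
move=> cdV; exists (A_eps_obj_axioms cdV), (@A_eps_hom_contractive d V).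
split; first exact: A_eps_embedding.
split; first exact: A_eps_full.
split; [exact: A_eps_has_right_adjoint|exact: A_eps_image].
Qed.
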